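(* Let $\mathcal R$ be an associative unital algebra over $\mathbb C$, $M$ an $n\times n$ matrix over $\mathcal R$, and $t$ a formal variable commuting with all elements of $\mathcal R$. (i) If $M$ is a Manin matrix and $\det^{column}(t-M)=\sum_{i=0}^{n}h_i t^i$ with $h_i\in\mathcal R$, then $$\sum_{i=0}^{n}h_i M^i=0,$$ that is, $\det^{column}(t-M)\big|_{t=M}=0$ with substitution from the right. (ii) If the transpose $M^t$ is a Manin matrix and $\det^{row}(t-M)=\sum_{i=0}^n h_i t^i$ with $h_i\in\mathcal R$, then $$\sum_{i=0}^{n} M^i h_i=0,$$ that is, $\det^{row}(t-M)\big|_{t=M}=0$ with substitution from the left.
   Context: A matrix $M$ with entries $M_{ij}$ in a (not necessarily commutative) associative ring is called a Manin matrix if (1) elements in the same column commute with each other, and (2) $[M_{ij},M_{kl}]=[M_{kj},M_{il}]$ for all $i,j,k,l$. For an $n\times n$ matrix $N$: $\det^{column}N=\sum_{\sigma\in S_n}(-1)^{\sigma}N_{\sigma(1),1}N_{\sigma(2),2}\cdots N_{\sigma(n),n}$ and $\det^{row}N=\sum_{\sigma\in S_n}(-1)^{\sigma}N_{1,\sigma(1)}N_{2,\sigma(2)}\cdots N_{n,\sigma(n)}$. Here $t-M$ means $t\cdot \mathrm{Id}-M$, and $h_iM^i$ (resp. $M^ih_i$) is the matrix $M^i$ with every entry multiplied by the element $h_i$ on the left (resp. on the right). *)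

(* Defs.v *)
From HB Require Import structures.
From mathcomp Require Import all_boot all_order all_fingroup all_algebra.
From mathcomp Require Import reals complex.

Set Implicit Arguments.
Unset Strict Implicit.
Unset Printing Implicit Defensive.

Import Order.TTheory GRing.Theory Num.Theory.
Local Open Scope ring_scope.

Definition commr (A : pzRingType) (a b : A) : A := a * b - b * a.

Definition manin (A : pzRingType) (m n : nat) (M : 'M[A]_(m, n)) : Prop :=
  (forall (i k : 'I_m) (j : 'I_n), GRing.comm (M i j) (M k j)) /\
  (forall (i k : 'I_m) (j l : 'I_n),
     commr (M i j) (M k l) = commr (M k j) (M i l)).

(* The products over j : 'I_n are taken in the order j = 0, 1, ..., n - 1,
   which matters because the ring need not be commutative. *)
Definition det_col (A : pzRingType) (n : nat) (N : 'M[A]_n) : A :=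
  \sum_(s : 'S_n) (-1) ^+ s * \prod_(j < n) N (s j) j.

Definition det_row (A : pzRingType) (n : nat) (N : 'M[A]_n) : A :=
  \sum_(s : 'S_n) (-1) ^+ s * \prod_(j < n) N j (s j).

(* \det is defined by the row-ordered Leibniz formula over any ring; in
   particular det_row (char_poly_mx M) is the library's char_poly M. *)
Lemma det_rowE (A : pzRingType) (n : nat) (N : 'M[A]_n) : det_row N = \det N.
Proof. by []. Qed.

Definition lmul_mx (A : pzRingType) (m n : nat) (h : A) (N : 'M[A]_(m, n)) :
  'M[A]_(m, n) := map_mx (fun x => h * x) N.

Definition rmul_mx (A : pzRingType) (m n : nat) (N : 'M[A]_(m, n)) (h : A) :
  'M[A]_(m, n) := map_mx (fun x => x * h) N.

(* Main.v *)
(* Swapping two adjacent columns of a Manin matrix changes the sign of its column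
   determinant, and the determinant vanishes when two columns are equal; hence
   Manin matrices have a left adjugate: B N = det(N) I. The matrix t - M is
   again Manin, so det(t - M) I = B(t) (t - M), and substituting M for t on the
   right gives 0. Part (ii) is the mirror image, obtained by passing to the
   transpose over the converse ring. *)

Require Import Defs.
From HB Require Import structures.
From mathcomp Require Import all_boot all_order all_fingroup all_algebra.
From mathcomp Require Import reals complex.

Set Implicit Arguments.
Unset Strict Implicit.
Unset Printing Implicit Defensive.

Import Order.TTheory GRing.Theory Num.Theory.
Local Open Scope ring_scope.

(** * Signed sums over permutations and ordered products *)

Lemma sum_perm_alternating (V : zmodType) (T : finType) (t : {perm T})
    (F : {perm T} -> V) :
  odd_perm t -> (forall s, F (t * s)%g = - F s) -> \sum_s F s = 0.
Proof.
(* Left translation by [t] exchanges the odd and even halves, so they cancel without dividing by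
   2. *)
move=> odd_t Ft; rewrite (bigID (@odd_perm T)) /=.
rewrite (reindex_inj (mulgI t)) /= addrC; apply/eqP; rewrite addr_eq0 -sumrN.
apply/eqP/eq_big => [s|s _]; first by rewrite odd_permM odd_t addTb.
by rewrite Ft opprK.
Qed.

(** [L] and [R] are built from [g] away from [i0] and [i1], so one pair serves all products that
    differ only at these neighbouring positions. This lets the terms of [s] and [t * s] be compared
    without commutativity. *)
Lemma prod_ord_adjacent (A : pzRingType) (n : nat) (g : 'I_n -> A)
    (i0 i1 : 'I_n) :
  i1 = i0.+1 :> nat ->
  exists L R : A, forall g' : 'I_n -> A,
    (forall j, j != i0 -> j != i1 -> g' j = g j) ->
    \prod_(j < n) g' j = L * (g' i0 * g' i1) * R.
Proof.
move=> i1E; pose G (h : 'I_n -> A) m := oapp h 1 (insub m).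
exists (\prod_(0 <= m < i0) G g m), (\prod_(i1.+1 <= m < n) G g m) => g' g'E.
have GE h (j : 'I_n) : G h j = h j by rewrite /G valK.
have GG (m : nat) : m != i0 -> m != i1 -> G g' m = G g m.
  move=> m0 m1; rewrite /G; case: insubP => //= u _ uE.
  by apply: g'E; rewrite -(inj_eq val_inj) /= uE.
have -> : \prod_(j < n) g' j = \prod_(0 <= m < n) G g' m.
  by rewrite big_mkord; apply: eq_bigr => j _; rewrite GE.
rewrite (big_cat_nat (n := i0)) ?(ltnW (ltn_ord i0)) //=.
rewrite (big_ltn (ltn_ord i0)) -i1E (big_ltn (ltn_ord i1)) !GE !mulrA.
congr (_ * _ * _ * _); apply: eq_big_nat => m /andP[lo hi]; apply: GG.
- by rewrite neq_ltn hi.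
- by rewrite neq_ltn i1E ltnS (ltnW hi).
- by rewrite neq_ltn (ltn_trans _ lo) ?orbT // i1E.
- by rewrite neq_ltn lo orbT.
Qed.

(** * Column determinants of Manin matrices *)

Section ManinDeterminant.
Variable A : pzRingType.

Lemma manin_colsub m n p (f : 'I_p -> 'I_n) (N : 'M[A]_(m, n)) :
  manin N -> manin (colsub f N).
Proof. by case=> Nc Nx; split=> *; rewrite !mxE. Qed.

Lemma manin_col_perm m n (s : 'S_n) (N : 'M[A]_(m, n)) :
  manin N -> manin (col_perm s N).
Proof. by rewrite col_permEsub; apply: manin_colsub. Qed.

(** In the sum of the two determinants, the term of [s] is a sign times [L * commr (N (s i0) i0) (N
    (s i1) i1) * R]; the cross relation makes it alternate under [s -> t * s]. *)
Lemma det_col_adjacent_swap n (N : 'M[A]_n) (i0 i1 : 'I_n) :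
  i1 = i0.+1 :> nat -> manin N ->
  det_col (col_perm (tperm i0 i1) N) = - det_col N.
Proof.
move=> i1E [_ Nx]; set t := tperm i0 i1.
have odd_t : odd_perm t.
  by rewrite odd_tperm -(inj_eq val_inj) /= i1E neq_ltn leqnn.
apply/eqP; rewrite -addr_eq0 /det_col (reindex_inj (mulgI t)) /= -big_split /=.
apply/eqP/(sum_perm_alternating odd_t) => s.
rewrite mulgA tperm2 mul1g odd_permM odd_t addTb signrN.
have [L [R prodE]] := prod_ord_adjacent (fun j => N (s j) j) i1E.
have tD j : j != i0 -> j != i1 -> t j = j.
  by move=> j0 j1; rewrite tpermD // eq_sym.
rewrite !prodE; try by move=> j j0 j1; rewrite ?mxE ?permM ?tD.
rewrite !mxE !permM tpermL tpermR.
rewrite !mulNr opprD opprK -!mulrBr -!mulrBl -!mulrBr.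
congr (_ * (_ * _ * _)); exact: Nx.
Qed.

(** The products of [s] and [t * s] differ by the order of two entries of one column, which commute.
    The swap rule alone would only give [det_col N + det_col N = 0]. *)
Lemma det_col_adjacent_eq n (N : 'M[A]_n) (i0 i1 : 'I_n) :
  i1 = i0.+1 :> nat -> manin N -> (forall i, N i i0 = N i i1) ->
  det_col N = 0.
Proof.
move=> i1E [Nc _] N01; set t := tperm i0 i1.
have odd_t : odd_perm t.
  by rewrite odd_tperm -(inj_eq val_inj) /= i1E neq_ltn leqnn.
apply: (sum_perm_alternating odd_t) => s.
rewrite odd_permM odd_t addTb signrN mulNr; congr (- (_ * _)).
have [L [R prodE]] := prod_ord_adjacent (fun j => N (s j) j) i1E.
rewrite !prodE // => [|j j0 j1]; last by rewrite permM tpermD // eq_sym.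
by rewrite !permM tpermL tpermR -!N01 Nc.
Qed.

Lemma det_col_tperm n (N : 'M[A]_n) (i j : 'I_n) :
  i != j -> manin N -> det_col (col_perm (tperm i j) N) = - det_col N.
Proof.
move=> neij; wlog ltij : i j neij / (i < j)%N => [hw|].
  case: (ltngtP i j) => [||/val_inj eij]; first exact: hw.
    by move=> lt; rewrite tpermC; apply: hw => //; rewrite eq_sym.
  by rewrite eij eqxx in neij.
have [m jE] : exists m, j = m :> nat by exists j.
elim: m j jE neij ltij N => [|m IHm] j jE neij; first by rewrite jE.
rewrite jE ltnS leq_eqVlt => /orP[/eqP im|ltim] N maninN.
  by rewrite det_col_adjacent_swap // jE im.
have ltmn : (m < n)%N by apply: leq_trans (ltn_ord j); rewrite jE.
pose k := Ordinal ltmn.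
(* As [k] is just before [j], this conjugates [tperm i k] by an adjacent transposition; its three
   factors contribute three sign changes. *)
have -> : tperm i j = (tperm k j * (tperm i k * tperm k j))%g.
  rewrite -{1}(tpermV k j) -[RHS]/(tperm i k ^ tperm k j)%g.
  rewrite (tpermC i k) tpermJ_tperm 1?tpermC // -(inj_eq val_inj) /=.
    by rewrite neq_ltn ltim orbT.
  by rewrite jE neq_ltn ltnS (ltnW ltim) orbT.
have neik : i != k by rewrite -(inj_eq val_inj) neq_ltn ltim.
rewrite !col_permM det_col_adjacent_swap //; last by do 2!apply: manin_col_perm.
rewrite IHm //; last exact: manin_col_perm.
by rewrite det_col_adjacent_swap ?opprK.
Qed.

Lemma det_col_perm n (N : 'M[A]_n) (s : 'S_n) :
  manin N -> det_col (col_perm s N) = (-1) ^+ s * det_col N.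
Proof.
case: (prod_tpermP s) => ts -> {s}.
elim: ts N => [|[i j] ts IHts] N /= dts maninN.
  by rewrite big_nil col_perm1 odd_perm1 mul1r.
case/andP: dts => neij dts; rewrite big_cons col_permM /= det_col_tperm //.
  by rewrite IHts // odd_permM odd_tperm neij addTb signrN mulNr.
exact: manin_col_perm.
Qed.

Lemma det_col_alternate n (N : 'M[A]_n) (i j : 'I_n) :
  manin N -> i != j -> (forall k, N k i = N k j) -> det_col N = 0.
Proof.
move=> maninN; wlog ltij : i j / (i < j)%N => [hw neij Nij|_ Nij].
  case: (ltngtP i j) => [lt|lt|/val_inj eij]; first exact: (hw i j).
    by apply: (hw j i) => //; rewrite eq_sym.
  by rewrite eij eqxx in neij.
have lti1 : (i.+1 < n)%N by apply: leq_ltn_trans (ltn_ord j).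
(* Exchanging columns [j] and [k = i + 1] makes the equal columns adjacent, at the price of a
   sign. *)
pose k := Ordinal lti1.
have [jk|nejk] := eqVneq j k.
  by apply: (@det_col_adjacent_eq _ _ i j) => //; rewrite jk.
apply/oppr_inj; rewrite oppr0 -(det_col_tperm nejk maninN).
apply: (@det_col_adjacent_eq _ _ i k) => //.
  exact: manin_col_perm.
move=> l; rewrite !mxE tpermR tpermD // -(inj_eq val_inj) neq_ltn.
  by rewrite ltij orbT.
by rewrite /= leqnn orbT.
Qed.

(* The i-th row of the left adjugate comes from the determinant with columns i
   and n - 1 exchanged, by dropping the last factor of each product: putting
   back any entry of column j there gives a determinant with a repeated column
   unless j = i, so no cofactor expansion is needed. *)
Lemma manin_left_adjugate n (N : 'M[A]_n) :
  manin N -> exists B : 'M[A]_n, B *m N = (det_col N)%:M.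
Proof.
case: n N => [|n] N maninN; first by exists 0; apply/matrixP => -[].
pose t i : 'S_n.+1 := tperm i ord_max.
pose w := widen_ord (leqnSn n).
exists (\matrix_(i, k) ((-1) ^+ t i * \sum_(s : 'S_n.+1 | s ord_max == k)
          (-1) ^+ s * \prod_(j < n) N (s (w j)) (t i (w j)))).
apply/matrixP => i j; rewrite !mxE.
pose f l := if l == ord_max then j else t i l.
transitivity ((-1) ^+ t i * det_col (colsub f N)).
  rewrite /det_col (partition_big (fun s : 'S_n.+1 => s ord_max) predT) //=.
  rewrite mulr_sumr; apply: eq_bigr => k _; rewrite mxE -mulrA; congr (_ * _).
  rewrite mulr_suml; apply: eq_bigr => s /eqP smax; rewrite -mulrA.
  congr (_ * _).
  rewrite big_ord_recr /= !mxE smax /f eqxx; congr (_ * _).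
  apply: eq_bigr => l _; rewrite !mxE ifN // -(inj_eq val_inj) /=.
  by rewrite neq_ltn ltn_ord.
have [eij|neij] := eqVneq i j.
  have -> : colsub f N = col_perm (t i) N.
    apply/matrixP => k l; rewrite !mxE /f; case: eqP => // ->.
    by rewrite /t tpermR eij.
  by rewrite det_col_perm // mulrA -expr2 sqrr_sign mul1r mulr1n.
(* For [i != j], columns [ord_max] and [t i j] of [colsub f N] are both column [j] of [N]. *)
rewrite mulr0n (@det_col_alternate _ _ ord_max (t i j)) ?mulr0 //.
- exact: manin_colsub.
- by rewrite -(inj_eq (@perm_inj _ (t i))) tpermK /t tpermR.
move=> k; rewrite !mxE /f eqxx ifN ?tpermK //.
by rewrite -(inj_eq (@perm_inj _ (t i))) tpermK /t tpermR eq_sym.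
Qed.

End ManinDeterminant.

(** * Row determinants through the converse ring *)

Lemma prod_ord_converse (A : pzRingType) n (g : 'I_n -> A) :
  \prod_(j < n) g j = \prod_(j < n) (g (rev_ord j) : A^c).
Proof.
elim: n g => [|n IHn] g; first by rewrite !big_ord0.
rewrite big_ord_recl big_ord_recr /= [RHS]/(_ * _)/=.
congr (_ * _); first by congr g; apply/val_inj; rewrite /= subSS subnn.
rewrite IHn; apply: eq_bigr => j _; congr g; apply/val_inj => /=.
by rewrite /bump /= add1n subSS subnSK.
Qed.

(** The converse product negates every commutator, so both Manin conditions survive. *)
Lemma manin_converse (A : pzRingType) m n (N : 'M[A]_(m, n)) :
  manin N -> @manin A^c m n N.
Proof.
case=> Nc Nx; split=> [i k j|i k j l]; first exact/commr_sym/Nc.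
by rewrite /commr; apply/oppr_inj; rewrite !opprB; apply: Nx.
Qed.

(* In the converse ring the factors of det_row come in reverse order; listing
   the columns backwards restores it, and the sign of the reversal cancels. *)
Lemma det_row_converse (A : pzRingType) n (N : 'M[A]_n) :
  manin N^T -> det_row N = @det_col A^c n N^T.
Proof.
move=> /manin_converse maninNT; pose r := perm (@rev_ord_inj n).
rewrite -[RHS]mul1r -(sqrr_sign A^c r) expr2 -mulrA -det_col_perm //.
rewrite /det_row /det_col (reindex_inj (mulgI r)) /= mulr_sumr.
(* Signs become conditional opposites, leaving a product in [A] to compare with one in [A^c]. *)
apply: eq_bigr => s _; rewrite mulr_sign mulrA -signr_addb -odd_permM mulr_sign.
suff -> : \prod_(j < n) N j ((r * s)%g j)
        = \prod_(j < n) (col_perm r N^T (s j) j : A^c) by [].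
rewrite prod_ord_converse; apply: eq_bigr => j _.
by rewrite !mxE permM !permE rev_ordK.
Qed.

Lemma manin_right_adjugate (A : pzRingType) n (N : 'M[A]_n) :
  manin N^T -> exists B : 'M[A]_n, N *m B = (det_row N)%:M.
Proof.
move=> maninNT; have [B BN] := manin_left_adjugate (manin_converse maninNT).
(* The product of [A^c] reverses factors, so transposing [BN] moves the adjugate to the right of
   [N]. *)
exists B^T; rewrite det_row_converse //; apply/matrixP => i j.
have /matrixP/(_ j i) := BN; rewrite !mxE eq_sym => <-.
by apply: eq_bigr => k _; rewrite !mxE.
Qed.

(** * The matrix t - M and substitution of M for t *)

Lemma mul_mx_scalarE (A : pzRingType) m n (B : 'M[A]_(m, n)) (a : A) i j :
  (B *m a%:M) i j = B i j * a.
Proof.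
rewrite mxE (bigD1 j) //= big1 => [|k /negPf nekj]; rewrite mxE.
  by rewrite eqxx addr0.
by rewrite nekj mulr0.
Qed.

(** Each entry is a central element, ['X] or 0, minus a constant polynomial, so its commutators are
    those of the entries of [M]. *)
Lemma manin_char_poly_mx (A : nzRingType) n (M : 'M[A]_n) :
  manin M -> manin (char_poly_mx M).
Proof.
have commX (p : {poly A}) b : GRing.comm p ('X *+ b).
  exact/commrMn/commr_polyX.
have commB (x y u v : {poly A}) : (forall p, GRing.comm p x) ->
    (forall p, GRing.comm p y) -> commr (x - u) (y - v) = commr u v.
  move=> cx cy; have subK (a b c : {poly A}) : a - b - (a - c) = c - b.
    by rewrite opprB addrC addrA subrK.
  rewrite /commr [(x - u) * _]mulrBl [_ * (x - u)]mulrBr -(cx (y - v)) subK.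
  by rewrite mulrBl mulrBr (cy u) subK.
case=> Mc Mx; split=> [i k j|i k j l]; rewrite !mxE; last first.
  by rewrite !commB // /commr -!polyCM -!polyCB; congr _%:P; apply: Mx.
by apply/subr0_eq; rewrite -/(commr _ _) commB // /commr -!polyCM Mc subrr.
Qed.

Section RootOfFactor.
Variables (A : nzRingType) (n : nat) (M : 'M[A]_n) (d : {poly A}).

(* If d I = B(t) (t - M), then d_k I = B_(k-1) - B_k M, so the sum telescopes. *)
Lemma right_root_sum m (B : 'M[{poly A}]_n) :
  B *m char_poly_mx M = d%:M ->
  \sum_(k < m.+1) (d`_k)%:M *m M ^+ k = - (map_mx (coefp m) B *m M ^+ m.+1).
Proof.
move=> BM; pose b k := map_mx (coefp k) B.
(* Coefficients of ['X^k] are compared; the [if] stands for [b (k - 1)], read as 0 at [k = 0]. *)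
have dE k : (d`_k)%:M = (if k is k'.+1 then b k' else 0) - b k *m M.
  apply/matrixP => i j.
  have -> : (d`_k)%:M i j = ((B *m char_poly_mx M) i j)`_k.
    by rewrite BM !mxE coefMn.
  rewrite mulmxBr mxE mul_mx_scalarE !mxE coefB coefMX coef_sum; congr (_ - _).
    by case: k => [|k]; rewrite !mxE.
  by apply: eq_bigr => l _; rewrite !mxE coefMC.
elim: m => [|m IHm].
  by rewrite big_ord1 dE sub0r mulNmx expr0 mulmx1 expr1.
rewrite big_ord_recr /= IHm dE mulmxBl addKr -mulmxA.
by rewrite -[M *m _]/(M * _) -exprS.
Qed.

(** Here [d_k I = B_(k-1) - M B_k], and multiplying by [M^k] on the left telescopes. *)
Lemma left_root_sum m (B : 'M[{poly A}]_n) :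
  char_poly_mx M *m B = d%:M ->
  \sum_(k < m.+1) M ^+ k *m (d`_k)%:M = - (M ^+ m.+1 *m map_mx (coefp m) B).
Proof.
move=> MB; pose b k := map_mx (coefp k) B.
have dE k : (d`_k)%:M = (if k is k'.+1 then b k' else 0) - M *m b k.
  apply/matrixP => i j.
  have -> : (d`_k)%:M i j = ((char_poly_mx M *m B) i j)`_k.
    by rewrite MB !mxE coefMn.
  rewrite mulmxBl mul_scalar_mx !mxE coefB coefXM coef_sum; congr (_ - _).
    by case: k => [|k]; rewrite !mxE.
  by apply: eq_bigr => l _; rewrite !mxE coefCM.
elim: m => [|m IHm].
  by rewrite big_ord1 dE sub0r mulmxN expr0 mul1mx expr1.
rewrite big_ord_recr /= IHm dE mulmxBr addKr mulmxA.
by rewrite -[_ *m M]/(_ * M) -exprSr.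
Qed.

(** Supplies an index, beyond any prescribed length, at which the boundary term of the telescoping
    sum vanishes. *)
Lemma coefp_mx_eventually0 (B : 'M[{poly A}]_n) N :
  exists2 m, (N <= m)%N & map_mx (coefp m) B = 0.
Proof.
exists (N + \max_i \max_j size (B i j))%N; first exact: leq_addr.
apply/matrixP => i j; rewrite !mxE /= nth_default //.
apply: leq_trans (leq_addl _ _); apply: leq_trans (leq_bigmax i).
exact: (leq_bigmax (F := fun j => size (B i j)) j).
Qed.

Lemma sum_widen0 (V : zmodType) (F : nat -> V) p m :
  (p <= m)%N -> (forall k, (p <= k)%N -> F k = 0) ->
  \sum_(k < p) F k = \sum_(k < m) F k.
Proof.
move=> lepm F0; rewrite (big_ord_widen _ F lepm) big_mkcond.
apply: eq_bigr => k _.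
by case: ltnP => // /F0 ->.
Qed.

Lemma right_root (B : 'M[{poly A}]_n) p :
  (size d <= p)%N -> B *m char_poly_mx M = d%:M ->
  \sum_(k < p) (d`_k)%:M *m M ^+ k = 0.
Proof.
move=> led BM; have [m lepm bm0] := coefp_mx_eventually0 B p.
(* Coefficients of [d] from [p] on are 0, so the sum extends to the [m.+1] terms that telescope. *)
rewrite (sum_widen0 (F := fun k => (d`_k)%:M *m M ^+ k) (leqW lepm)).
  by rewrite (right_root_sum m BM) bm0 mul0mx oppr0.
by move=> k lepk; rewrite nth_default ?(leq_trans led) // raddf0 mul0mx.
Qed.

Lemma left_root (B : 'M[{poly A}]_n) p :
  (size d <= p)%N -> char_poly_mx M *m B = d%:M ->
  \sum_(k < p) M ^+ k *m (d`_k)%:M = 0.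
Proof.
move=> led MB; have [m lepm bm0] := coefp_mx_eventually0 B p.
rewrite (sum_widen0 (F := fun k => M ^+ k *m (d`_k)%:M) (leqW lepm)).
  by rewrite (left_root_sum m MB) bm0 mulmx0 oppr0.
by move=> k lepk; rewrite nth_default ?(leq_trans led) // raddf0 mulmx0.
Qed.

End RootOfFactor.

(** The assumed expansion itself gives the size bound under which [right_root] and [left_root] apply
    with [p = n.+1]. *)
Lemma sum_polyCX (A : nzRingType) p (h : 'I_p -> A) (d : {poly A}) :
  d = \sum_(i < p) (h i)%:P * 'X^i ->
  (size d <= p)%N /\ forall i : 'I_p, d`_i = h i.
Proof.
move=> ->; split=> [|i].
  apply/leq_sizeP => k lepk; rewrite coef_sum big1 // => i _.
  by rewrite coefCM coefXn gtn_eqF ?mulr0 // (leq_trans (ltn_ord i)).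
rewrite coef_sum (bigD1 i) //= big1 => [|j neji]; rewrite coefCM coefXn.
  by rewrite eqxx mulr1 addr0.
by rewrite [_ == _](inj_eq val_inj) eq_sym (negPf neji) mulr0.
Qed.

Theorem theorem3 (R : realType) (A : algType (complex R)) (n : nat)
    (M : 'M[A]_n) :
  (forall h : 'I_n.+1 -> A,
     manin M ->
     det_col ('X%:M - map_mx polyC M) = \sum_(i < n.+1) (h i)%:P * 'X^i ->
     \sum_(i < n.+1) lmul_mx (h i) (M ^+ i) = 0)
  /\
  (forall h : 'I_n.+1 -> A,
     manin M^T ->
     det_row ('X%:M - map_mx polyC M) = \sum_(i < n.+1) (h i)%:P * 'X^i ->
     \sum_(i < n.+1) rmul_mx (M ^+ i) (h i) = 0).
Proof.
split=> h maninM /sum_polyCX[sz_d dE].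
  have [B BM] := manin_left_adjugate (manin_char_poly_mx maninM).
  rewrite -[RHS](right_root sz_d BM); apply: eq_bigr => i _.
  by rewrite dE mul_scalar_mx; apply/matrixP => j k; rewrite !mxE.
have maninT : manin (char_poly_mx M)^T.
  (* Transposing [t - M] gives the same matrix built from [M^T]. *)
  by rewrite linearB /= tr_scalar_mx map_trmx; apply: manin_char_poly_mx.
have [B MB] := manin_right_adjugate maninT.
rewrite -[RHS](left_root sz_d MB); apply: eq_bigr => i _.
by apply/matrixP => j k; rewrite dE mul_mx_scalarE !mxE.
Qed.
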